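(* Let $1\leqslant p<2$, $1\leqslant q\leqslant p$, and let $\boldsymbol{y}\in\mathcal{S}_p$. Then the set $\partial C_{p,q}(\boldsymbol{y})$ of all subgradients of $C_{p,q}$ at $\boldsymbol{y}$ is as follows. (i) If $p=q=1$: $\partial C_{1,1}(\boldsymbol{y})=\{\nabla D_{1,1}(\boldsymbol{y})+\boldsymbol{u} : \boldsymbol{u}\in\mathbb{R}^d,\ -a^{(t)}\leqslant u^{(t)}\leqslant a^{(t)}\ \text{for all } 1\leqslant t\leqslant d\}$, where $a^{(t)}=\sum_{i\in V_t(\boldsymbol{y})}\eta_i$. (ii) If $q=1$, $1<p<2$ and $\boldsymbol{y}\in\mathcal{S}_p\setminus\{\boldsymbol{x}_i\}_{i=1}^m$: $\partial C_{p,1}(\boldsymbol{y})=\{\nabla D_{p,1}(\boldsymbol{y})\}$. (iii) If $q=1$, $1<p<2$ and $\boldsymbol{y}=\boldsymbol{x}_l$ for some $l\in\{1,\dots,m\}$: $\partial C_{p,1}(\boldsymbol{x}_l)=\{\nabla D_{p,1}(\boldsymbol{x}_l)+\eta_l\boldsymbol{b} : \boldsymbol{b}\in\mathbb{R}^d,\ \|\boldsymbol{b}\|_r\leqslant 1\}$, where $\|\cdot\|_r$ is the conjugate norm of $\|\cdot\|_p$, i.e. $\frac1r+\frac1p=1$. (iv) If $1<q\leqslant p$ and $1<p<2$: $\partial C_{p,q}(\boldsymbol{y})=\{\nabla D_{p,q}(\boldsymbol{y})\}$.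
   Context: Data: $\boldsymbol{x}_1,\dots,\boldsymbol{x}_m\in\mathbb{R}^d$ are fixed data points, distinct and non-collinear, with weights $\eta_1,\dots,\eta_m>0$. Superscript $(t)$ denotes the $t$-th coordinate, $1\leqslant t\leqslant d$, and $\|\cdot\|_p$ is the $\ell_p$ norm on $\mathbb{R}^d$. Cost function: $C_{p,q}(\boldsymbol{y}):=\sum_{i=1}^m \eta_i^q\|\boldsymbol{y}-\boldsymbol{x}_i\|_p^q$ for $\boldsymbol{y}\in\mathbb{R}^d$ (a convex function). Singular set: $\mathcal{S}_p:=\{\boldsymbol{y}\in\mathbb{R}^d : \exists i\in\{1,\dots,m\},\ \exists t\in\{1,\dots,d\}\text{ such that } y^{(t)}=x_i^{(t)}\}$. Subgradient: $\boldsymbol{v}\in\mathbb{R}^d$ is a subgradient of $C_{p,q}$ at $\boldsymbol{y}$ if $C_{p,q}(\boldsymbol{z})-C_{p,q}(\boldsymbol{y})\geqslant \boldsymbol{v}^\top(\boldsymbol{z}-\boldsymbol{y})$ for all $\boldsymbol{z}\in\mathbb{R}^d$; $\partial C_{p,q}(\boldsymbol{y})$ is the set of all subgradients at $\boldsymbol{y}$. Singular index set: $V_t(\boldsymbol{y}):=\{i\in\{1,\dots,m\} : y^{(t)}=x_i^{(t)}\}$. De-singularity subgradient: $\nabla D_{p,q}(\boldsymbol{y})\in\mathbb{R}^d$ denotes the vector defined by $$\big(\nabla D_{p,q}(\boldsymbol{y})\big)^{(t)}:=\sum_{i\notin V_t(\boldsymbol{y})} q\,\eta_i^q\|\boldsymbol{y}-\boldsymbol{x}_i\|_p^{q-p}|y^{(t)}-x_i^{(t)}|^{p-2}(y^{(t)}-x_i^{(t)}),\qquad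 1\leqslant t\leqslant d.$$ *)

(* Defs.v *)
From HB Require Import structures.
From mathcomp Require Import all_boot all_order all_algebra.
From mathcomp Require Import all_classical all_reals all_analysis.

Set Implicit Arguments.
Unset Strict Implicit.
Unset Printing Implicit Defensive.

Import Order.TTheory GRing.Theory Num.Theory.

Local Open Scope classical_set_scope.
Local Open Scope ring_scope.

(* Points of R^d are column vectors [y : 'cV[R]_d];
   the coordinate y^(t) is [y t 0]. *)

Definition lpnorm (R : realType) (d : nat) (p : R) (v : 'cV[R]_d) : R :=
  (\sum_(t < d) `|v t 0| `^ p) `^ p^-1.

(* The direction [v] may be 0: this only makes a difference for families of
   equal points, which count as collinear. *)
Definition collinear (R : realType) (d m : nat) (x : 'I_m -> 'cV[R]_d) : Prop :=
  exists a v : 'cV[R]_d, forall i, exists c : R, x i = a + c *: v.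

Definition cost (R : realType) (d m : nat) (x : 'I_m -> 'cV[R]_d)
    (eta : 'I_m -> R) (p q : R) (y : 'cV[R]_d) : R :=
  \sum_(i < m) eta i `^ q * lpnorm p (y - x i) `^ q.

Definition singular_set (R : realType) (d m : nat) (x : 'I_m -> 'cV[R]_d) :
    set 'cV[R]_d :=
  [set y | exists i, exists t, y t 0 = x i t 0].

Definition subdifferential (R : realType) (d : nat) (f : 'cV[R]_d -> R)
    (y : 'cV[R]_d) : set 'cV[R]_d :=
  [set v | forall z, f z - f y >= (v^T *m (z - y)) 0 0].

Definition singular_index (R : realType) (d m : nat) (x : 'I_m -> 'cV[R]_d)
    (t : 'I_d) (y : 'cV[R]_d) : {set 'I_m} :=
  [set i | y t 0 == x i t 0]%SET.

(* The exponents q - p and p - 2 may be negative, but for [i] outside of V_t(y)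
   both bases are nonzero, so the value of [0 `^ a] at [a < 0] is never used. *)
Definition desing_subgradient (R : realType) (d m : nat)
    (x : 'I_m -> 'cV[R]_d) (eta : 'I_m -> R) (p q : R) (y : 'cV[R]_d) :
    'cV[R]_d :=
  \col_(t < d) \sum_(i < m | i \notin singular_index x t y)
    q * eta i `^ q * lpnorm p (y - x i) `^ (q - p) *
    `|y t 0 - x i t 0| `^ (p - 2) * (y t 0 - x i t 0).

(* Main.v *)
Require Import Defs.
From HB Require Import structures.
From mathcomp Require Import all_boot all_order all_algebra.
From mathcomp Require Import all_classical all_reals all_analysis.
From mathcomp Require Import ring lra.

Set Implicit Arguments.
Unset Strict Implicit.
Unset Printing Implicit Defensive.

Import Order.TTheory GRing.Theory Num.Theory.
Import numFieldNormedType.Exports.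

Local Open Scope classical_set_scope.
Local Open Scope ring_scope.

(** Write N for the l^p norm and G(w) for [lpgrad p q w], the vector with
    coordinates q N(w)^(q-p) |w_t|^(p-2) w_t. This is the gradient of N^q
    wherever N^q is differentiable, and it is 0 in every coordinate where w
    vanishes, so the de-singularity subgradient at y is the full sum of the
    eta_i^q G(y - x_i) ([desing_subgradientE]): the terms left out of it are
    zero anyway.

    _G(w) is a subgradient of N^q at w._ Hoelder's inequality gives
    <G(w), z> <= q N(w)^(q-1) N(z), with equality at z = w, so
    <G(w), z - w> <= q N(w)^(q-1) (N(z) - N(w)) <= N(z)^q - N(w)^q, the last
    step being the tangent line inequality for u |-> u^q
    ([lpgrad_subgradient]). Hence the de-singularity subgradient is a
    subgradient of the cost at every point
    ([desing_subgradient_subdifferential]).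

    _Upper bound on the subdifferential._ No derivative of the cost is computed.
    If v is a subgradient at y, monotonicity of the subdifferential compares it
    with the explicit subgradient at y + s h, for s > 0:
    <v, h> <= sum_i eta_i^q <G(y - x_i + s h), h>. Letting s tend to 0
    ([subdifferential_dot_le]), it remains to compute, for w = y - x_i, the limit
    of <G(w + s h), h>:
    - it is <G(w), h> when p > 1 and w <> 0, by continuity of G;
    - it is 0 when w = 0 and q > 1, and N(h) when w = 0 and q = 1, because
      <G(s h), h> = q s^(q-1) N(h)^q;
    - when p = q = 1, each coordinate where w vanishes adds |h_t| to <G(w), h>.

    If only <G(w), h> and 0 occur, then <v, h> is at most the product of h with
    the de-singularity subgradient D, for every h, whence v = D. If q = 1 and
    y = x_l, then <v - D, h> <= eta_l N(h) for every h, which says that v - D is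
    in the dual ball of radius eta_l ([lpnorm_dual_le1]). If p = q = 1, taking
    h = +-e_t bounds each coordinate of v - D by a_t. In these last two cases the
    reverse inclusion follows from the same estimates for N at the singular
    terms: Hoelder's inequality, respectively [lpgrad_p1q1_le]. *)

(** * Real powers *)

Lemma sqrM_powRB2 (R : realType) (p x : R) :
  0 < p -> `|x| `^ (p - 2) * x * x = `|x| `^ p.
Proof.
move=> p0; have [->|x0] := eqVneq x 0.
  by rewrite mulr0 normr0 powR0// gt_eqF.
rewrite powRB ?normr_eq0 ?x0 ?implybT// (powR_mulrn 2) ?normr_ge0//.
rewrite real_normK ?num_real// -mulrA -expr2 divfK// sqrf_eq0//.
Qed.

Lemma powRB2M_norm (R : realType) (p x : R) :
  1 < p -> `|x| `^ (p - 2) * `|x| = `|x| `^ (p - 1).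
Proof.
move=> p1; have p10 : 0 < p - 1 by rewrite subr_gt0.
by rewrite -(mulr_powRB1 (normr_ge0 x) p10) mulrC; congr (_ * _ `^ _); lra.
Qed.

(** At p = 1 and x = 0 the right-hand side is 0^0 = 1 while the left-hand side
    is 0: this is the only case where equality fails. *)
Lemma powRB2M_le (R : realType) (p x : R) :
  1 <= p -> `|x| `^ (p - 2) * `|x| <= `|x| `^ (p - 1).
Proof.
rewrite le_eqVlt => /predU1P[<-|p1]; last by rewrite powRB2M_norm.
rewrite subrr powRr0 (_ : 1 - 2 = -1) ?powR_inv1//; last by lra.
have [->|x0] := eqVneq x 0; first by rewrite normr0 mulr0.
by rewrite mulVf// normr_eq0.
Qed.

(** Young's inequality for the product a * b^(q-1), with exponents q and
    q / (q - 1). *)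
Lemma powR_tangent (R : realType) (q a b : R) :
  1 <= q -> 0 <= a -> 0 < b -> q * b `^ (q - 1) * (a - b) <= a `^ q - b `^ q.
Proof.
rewrite le_eqVlt => /predU1P[<-|q1] a0 b0.
  by rewrite subrr powRr0 !powRr1 ?(ltW b0)//; lra.
have q0 : 0 < q by lra.
have q10 : 0 < q - 1 by lra.
have r0 : 0 < q / (q - 1) by rewrite divr_gt0.
have conj : q^-1 + (q / (q - 1))^-1 = 1.
  rewrite invf_div; field; rewrite gt_eqF//.
have := conjugate_powR a0 (powR_ge0 b (q - 1)) q0 r0 conj.
rewrite -powRrM (_ : (q - 1) * (q / (q - 1)) = q); last first.
  by field; rewrite gt_eqF.
rewrite -(ler_pM2l q0).
rewrite (_ : q * (a `^ q / q + b `^ q / (q / (q - 1))) =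
   a `^ q + (q - 1) * b `^ q); last by field; rewrite !gt_eqF.
have bq : b `^ q = b * b `^ (q - 1) by rewrite mulr_powRB1// ltW.
rewrite bq; nra.
Qed.

Lemma cvg_powR_gt0 (R : realType) (T : Type) (F : set_system T) (f : T -> R)
    (a x : R) : Filter F -> 0 < a ->
  f s @[s --> F] --> a -> f s `^ x @[s --> F] --> a `^ x.
Proof.
move=> FF a0 fa; apply: (continuous_cvg FF (h := fun u : R => u `^ x)) fa.
apply: differentiable_continuous; apply/derivable1_diffP.
by apply: derivable_powR; rewrite in_itv/= a0.
Qed.

(** Nonnegativity of [f] matters at the limit 0, since a negative base has
    power 1. *)
Lemma cvg_powR_ge0 (R : realType) (T : Type) (F : set_system T) (f : T -> R)
    (a x : R) : Filter F -> 0 < x -> 0 <= a -> (forall s, 0 <= f s) ->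
  f s @[s --> F] --> a -> f s `^ x @[s --> F] --> a `^ x.
Proof.
move=> FF x0; rewrite le_eqVlt => /predU1P[<-|a0] f0 fa; last exact: cvg_powR_gt0.
rewrite powR0 ?gt_eqF//; apply/cvgr0Pnorm_lt => e e0.
have /cvgr0Pnorm_lt/(_ _ (powR_gt0 x^-1 e0)) := fa.
apply: filterS => s; rewrite !ger0_norm ?powR_ge0//.
move=> /(gt0_ltr_powR x0); rewrite !nnegrE f0 powR_ge0 -powRrM mulVf ?gt_eqF//.
by rewrite powRr1 ?ltW//; apply.
Qed.

(** * Norms *)

Lemma dotE (R : realType) d (v h : 'cV[R]_d) :
  (v^T *m h) 0 0 = \sum_t v t 0 * h t 0.
Proof. by rewrite mxE; apply: eq_bigr => t _; rewrite mxE. Qed.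

Lemma dot_addE (R : realType) d (u v h : 'cV[R]_d) :
  ((v + u)^T *m h) 0 0 = (v^T *m h) 0 0 + (u^T *m h) 0 0.
Proof. by rewrite linearD mulmxDl mxE. Qed.

Lemma dot_subE (R : realType) d (u v h : 'cV[R]_d) :
  ((v - u)^T *m h) 0 0 = (v^T *m h) 0 0 - (u^T *m h) 0 0.
Proof. by rewrite linearB mulmxBl mxE [X in _ + X]mxE. Qed.

Lemma lpnorm_ge0 (R : realType) d (p : R) (v : 'cV[R]_d) : 0 <= lpnorm p v.
Proof. exact: powR_ge0. Qed.

Lemma sum_powR_ge0 (R : realType) d (p : R) (v : 'cV[R]_d) :
  0 <= \sum_t `|v t 0| `^ p.
Proof. by apply: sumr_ge0 => t _; exact: powR_ge0. Qed.

Lemma lpnorm_powR (R : realType) d (p : R) (v : 'cV[R]_d) : 0 < p ->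
  lpnorm p v `^ p = \sum_t `|v t 0| `^ p.
Proof.
move=> p0; rewrite /lpnorm -powRrM mulVf ?gt_eqF//.
by rewrite powRr1 ?sum_powR_ge0.
Qed.

Lemma lpnorm1 (R : realType) d (v : 'cV[R]_d) : lpnorm 1 v = \sum_t `|v t 0|.
Proof.
rewrite -[LHS]powRr1 ?lpnorm_ge0// lpnorm_powR//.
by apply: eq_bigr => t _; rewrite powRr1.
Qed.

Lemma norm_le_lpnorm (R : realType) d (p : R) (v : 'cV[R]_d) t : 0 < p ->
  `|v t 0| <= lpnorm p v.
Proof.
move=> p0; rewrite -[leLHS]powRr1// -(@mulfV _ p) ?gt_eqF// powRrM.
apply: ge0_ler_powR; rewrite ?nnegrE ?powR_ge0 ?sum_powR_ge0//.
  by rewrite invr_ge0 ltW.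
rewrite (bigD1 t)//= lerDl.
by apply: sumr_ge0 => i _; exact: powR_ge0.
Qed.

Lemma lpnorm_eq0 (R : realType) d (p : R) (v : 'cV[R]_d) : 0 < p ->
  (lpnorm p v == 0) = (v == 0).
Proof.
move=> p0; apply/eqP/eqP => [v0|->].
  apply/matrixP => t j; rewrite ord1 mxE; apply/eqP.
  by rewrite -normr_le0 -v0 norm_le_lpnorm.
rewrite /lpnorm big1 ?powR0 ?invr_eq0 ?gt_eqF// => t _.
by rewrite mxE normr0 powR0 ?gt_eqF.
Qed.

Lemma lpnormZ (R : realType) d (p c : R) (v : 'cV[R]_d) : 0 < p ->
  lpnorm p (c *: v) = `|c| * lpnorm p v.
Proof.
move=> p0; rewrite /lpnorm.
under eq_bigr do rewrite mxE normrM powRM ?normr_ge0//.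
rewrite -mulr_sumr powRM ?powR_ge0 ?sum_powR_ge0// -powRrM mulfV ?gt_eqF//.
by rewrite powRr1.
Qed.

(** By homogeneity both norms may be taken equal to 1; then Young's inequality
    in each coordinate sums to 1/r + 1/p = 1. *)
Lemma hoelder_lpnorm (R : realType) d (p r : R) (b z : 'cV[R]_d) :
  0 < p -> 0 < r -> r^-1 + p^-1 = 1 ->
  \sum_t `|b t 0| * `|z t 0| <= lpnorm r b * lpnorm p z.
Proof.
move=> p0 r0 rp.
have [b0|b0] := eqVneq b 0.
  by rewrite b0 big1 ?mulr_ge0 ?lpnorm_ge0// => t _; rewrite mxE normr0 mul0r.
have [z0|z0] := eqVneq z 0.
  by rewrite z0 big1 ?mulr_ge0 ?lpnorm_ge0// => t _; rewrite mxE normr0 mulr0.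
have B0 : 0 < lpnorm r b by rewrite lt_neqAle lpnorm_ge0 eq_sym lpnorm_eq0 ?b0.
have Z0 : 0 < lpnorm p z by rewrite lt_neqAle lpnorm_ge0 eq_sym lpnorm_eq0 ?z0.
suff unit_hoelder (u v : 'cV[R]_d) : lpnorm r u = 1 -> lpnorm p v = 1 ->
    \sum_t `|u t 0| * `|v t 0| <= 1.
  have normV c : 0 < c -> `|c^-1| = c^-1 :> R.
    by move=> c0; rewrite gtr0_norm ?invr_gt0.
  have normalize e (w : 'cV[R]_d) : 0 < e -> 0 < lpnorm e w ->
      lpnorm e ((lpnorm e w)^-1 *: w) = 1.
    by move=> e0 w0; rewrite lpnormZ// normV// mulVf// gt_eqF.
  have := unit_hoelder _ _ (normalize r b r0 B0) (normalize p z p0 Z0).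
  move: (lpnorm r b) (lpnorm p z) B0 Z0 => B Z B0 Z0.
  under eq_bigr do rewrite !mxE !normrM mulrACA.
  rewrite -mulr_sumr (normV B)// (normV Z)// -invfM.
  by rewrite mulrC ler_pdivrMr ?mulr_gt0// mul1r.
move=> u1 v1; rewrite -rp.
have -> : r^-1 = (\sum_t `|u t 0| `^ r) / r.
  by rewrite -lpnorm_powR// u1 powR1 mul1r.
have -> : p^-1 = (\sum_t `|v t 0| `^ p) / p.
  by rewrite -lpnorm_powR// v1 powR1 mul1r.
rewrite !mulr_suml -big_split/=; apply: ler_sum => t _.
exact: conjugate_powR.
Qed.

Lemma dot_le_lpnorm (R : realType) d (p r : R) (b z : 'cV[R]_d) :
  0 < p -> 0 < r -> r^-1 + p^-1 = 1 ->
  (b^T *m z) 0 0 <= lpnorm r b * lpnorm p z.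
Proof.
move=> p0 r0 rp; apply: le_trans (hoelder_lpnorm b z p0 r0 rp).
by rewrite dotE; apply: ler_sum => t _; rewrite -normrM ler_norm.
Qed.

(** The converse of Hoelder's inequality: h = |b|^(r-2) b is the vector for which
    Hoelder's inequality is an equality, and testing on it gives
    N_r(b)^r <= N_r(b)^(r-1). *)
Lemma lpnorm_dual_le1 (R : realType) d (p r : R) (b : 'cV[R]_d) :
  1 < p -> 0 < r -> r^-1 + p^-1 = 1 ->
  (forall h : 'cV[R]_d, (b^T *m h) 0 0 <= lpnorm p h) -> lpnorm r b <= 1.
Proof.
move=> p1 r0 rp dual.
have p0 : 0 < p by lra.
have rV : r^-1 = 1 - p^-1 by rewrite -rp; lra.
have pV1 : 0 < 1 - p^-1 by rewrite subr_gt0 invf_lt1.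
have rE : r = p / (p - 1).
  by rewrite -[r]invrK rV; field; rewrite !gt_eqF ?subr_gt0//.
have [b0|b0] := eqVneq b 0.
  have /eqP -> : lpnorm r b == 0 by rewrite lpnorm_eq0 ?b0.
  exact: ler01.
have B0 : 0 < lpnorm r b by rewrite lt_neqAle lpnorm_ge0 eq_sym lpnorm_eq0 ?b0.
set N := lpnorm r b in B0 *.
have r1 : 1 < r by rewrite rE ltr_pdivlMr; lra.
pose h : 'cV[R]_d := \col_t (`|b t 0| `^ (r - 2) * b t 0).
have := dual h; rewrite dotE.
have -> : \sum_t b t 0 * h t 0 = N `^ r.
  rewrite lpnorm_powR//; apply: eq_bigr => t _.
  by rewrite mxE mulrC sqrM_powRB2.
have -> : lpnorm p h = N `^ (r / p).
  rewrite (powRrM N r) (lpnorm_powR b r0); congr (_ `^ _).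
  apply: eq_bigr => t _; rewrite mxE normrM ger0_norm ?powR_ge0//.
  rewrite powRB2M_norm// -powRrM; congr (_ `^ _).
  by rewrite rE; field; lra.
rewrite (_ : r / p = r - 1); last by rewrite rE; field; lra.
have r0' : 0 < r by lra.
rewrite -(mulr_powRB1 (ltW B0) r0').
by rewrite -[leRHS]mul1r ler_pM2r// powR_gt0.
Qed.

(** * The gradient of a power of the norm *)

Definition lpgrad (R : realType) d (p q : R) (w : 'cV[R]_d) : 'cV[R]_d :=
  \col_t (q * lpnorm p w `^ (q - p) * `|w t 0| `^ (p - 2) * w t 0).

Lemma lpgrad0 (R : realType) d (p q : R) : lpgrad p q 0 = 0 :> 'cV[R]_d.
Proof. by apply/matrixP => t j; rewrite !mxE mulr0. Qed.

Lemma lpgrad_dot_self (R : realType) d (p q : R) (w : 'cV[R]_d) :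
  0 < p -> 0 < q ->
  ((lpgrad p q w)^T *m w) 0 0 = q * lpnorm p w `^ q.
Proof.
move=> p0 q0; rewrite dotE.
have [->|w0] := eqVneq w 0.
  rewrite lpgrad0 big1; last by move=> t _; rewrite mxE mul0r.
  have /eqP -> : lpnorm p (0 : 'cV[R]_d) == 0 by rewrite lpnorm_eq0.
  by rewrite powR0 ?mulr0// gt_eqF.
have N0 : lpnorm p w != 0 by rewrite lpnorm_eq0.
have -> : \sum_t lpgrad p q w t 0 * w t 0 =
    q * lpnorm p w `^ (q - p) * \sum_t `|w t 0| `^ p.
  rewrite mulr_sumr; apply: eq_bigr => t _.
  by rewrite mxE -(sqrM_powRB2 _ p0); ring.
rewrite -lpnorm_powR// -mulrA -powRD ?N0 ?implybT//.
by rewrite subrK.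
Qed.

(** Hoelder's inequality for the vector of the |w_t|^(p-1), whose norm for the
    conjugate exponent is N(w)^(p-1). *)
Lemma sum_powRB1_le (R : realType) d (p : R) (w z : 'cV[R]_d) : 1 <= p ->
  \sum_t `|w t 0| `^ (p - 1) * `|z t 0| <= lpnorm p w `^ (p - 1) * lpnorm p z.
Proof.
rewrite le_eqVlt => /predU1P[<-|p1].
  rewrite subrr powRr0 mul1r lpnorm1.
  by apply: ler_sum => t _; rewrite powRr0 mul1r.
have p0 : 0 < p by lra.
pose r := p / (p - 1).
have r0 : 0 < r by rewrite divr_gt0// subr_gt0.
have pE : p - 1 = p / r by rewrite /r; field; lra.
have rE : (p - 1) * r = p by rewrite /r; field; lra.
have conj : r^-1 + p^-1 = 1 by rewrite /r; field; lra.
pose b : 'cV[R]_d := \col_t (`|w t 0| `^ (p - 1)).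
have -> : lpnorm p w `^ (p - 1) = lpnorm r b.
  rewrite pE (powRrM (lpnorm p w) p) (lpnorm_powR w p0); congr (_ `^ _).
  apply: eq_bigr => t _.
  by rewrite mxE (ger0_norm (powR_ge0 _ _)) -powRrM rE.
apply: le_trans (hoelder_lpnorm b z p0 r0 conj).
by apply: ler_sum => t _; rewrite mxE (ger0_norm (powR_ge0 _ _)).
Qed.

Lemma lpgrad_dot_le (R : realType) d (p q : R) (w z : 'cV[R]_d) :
  1 <= p -> 0 < q -> w != 0 ->
  ((lpgrad p q w)^T *m z) 0 0 <= q * lpnorm p w `^ (q - 1) * lpnorm p z.
Proof.
move=> p1 q0 w0; have p0 : 0 < p by lra.
have N0 : lpnorm p w != 0 by rewrite lpnorm_eq0.
have -> : q - 1 = (q - p) + (p - 1) by lra.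
rewrite powRD ?N0 ?implybT// -!mulrA.
apply: (@le_trans _ _ (q * (lpnorm p w `^ (q - p) *
    \sum_t `|w t 0| `^ (p - 1) * `|z t 0|))); last first.
  rewrite (ler_pM2l q0); apply: ler_wpM2l; first exact: powR_ge0.
  exact: sum_powRB1_le.
rewrite dotE mulrA mulr_sumr; apply: ler_sum => t _; rewrite mxE -2!mulrA.
have c0 : 0 <= q * lpnorm p w `^ (q - p) by rewrite mulr_ge0 ?powR_ge0 ?ltW.
apply: ler_wpM2l => //; apply: le_trans (ler_norm _) _.
rewrite mulrA !normrM (ger0_norm (powR_ge0 _ _)).
by apply: ler_wpM2r => //; exact: powRB2M_le.
Qed.

(** The bound [lpgrad_dot_le] is attained at [z = w]; it reduces the claim to
    the tangent line inequality for the power q. *)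
Lemma lpgrad_subgradient (R : realType) d (p q : R) (w : 'cV[R]_d) :
  1 <= p -> 1 <= q ->
  subdifferential (fun z => lpnorm p z `^ q) w (lpgrad p q w).
Proof.
move=> p1 q1 z; have q0 : 0 < q by lra.
have p0 : 0 < p by lra.
have [->|w0] := eqVneq w 0.
  have /eqP -> : lpnorm p (0 : 'cV[R]_d) == 0 by rewrite lpnorm_eq0.
  rewrite lpgrad0 dotE big1 ?subr_ge0; last by move=> t _; rewrite mxE mul0r.
  by rewrite powR0 ?gt_eqF// powR_ge0.
have N0 : 0 < lpnorm p w by rewrite lt_neqAle lpnorm_ge0 eq_sym lpnorm_eq0 ?w0.
apply: le_trans (powR_tangent q1 (lpnorm_ge0 p z) N0).
rewrite mulmxBr mxE [X in _ + X]mxE lpgrad_dot_self//.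
have Nq : lpnorm p w `^ q = lpnorm p w `^ (q - 1) * lpnorm p w.
  by rewrite mulrC mulr_powRB1// lpnorm_ge0.
rewrite mulrBr Nq !mulrA lerB// ; exact: lpgrad_dot_le.
Qed.

(** * Subgradients of the cost *)

(** The terms with [i] in V_t(y) may be added because they carry the factor
    y_t - x_it = 0. *)
Lemma desing_subgradientE (R : realType) d m (x : 'I_m -> 'cV[R]_d)
    (eta : 'I_m -> R) (p q : R) (y : 'cV[R]_d) :
  desing_subgradient x eta p q y = \sum_i eta i `^ q *: lpgrad p q (y - x i).
Proof.
apply/matrixP => t j; rewrite ord1 mxE summxE [RHS](bigID (fun i =>
  i \notin singular_index x t y))/= [X in _ = _ + X]big1 ?addr0.
  by apply: eq_bigr => i _; rewrite !mxE; ring.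
move=> i; rewrite negbK inE => /eqP yx.
by rewrite !mxE yx subrr mulr0 mulr0.
Qed.

Lemma desing_subgradient_dotE (R : realType) d m (x : 'I_m -> 'cV[R]_d)
    (eta : 'I_m -> R) (p q : R) (y h : 'cV[R]_d) :
  ((desing_subgradient x eta p q y)^T *m h) 0 0 =
  \sum_i eta i `^ q * ((lpgrad p q (y - x i))^T *m h) 0 0.
Proof.
rewrite desing_subgradientE linear_sum mulmx_suml summxE.
by apply: eq_bigr => i _; rewrite linearZ/= -scalemxAl mxE.
Qed.

Lemma desing_subgradient_subdifferential (R : realType) d m
    (x : 'I_m -> 'cV[R]_d) (eta : 'I_m -> R) (p q : R) (y : 'cV[R]_d) :
  1 <= p -> 1 <= q ->
  subdifferential (cost x eta p q) y (desing_subgradient x eta p q y).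
Proof.
move=> p1 q1 z; rewrite desing_subgradient_dotE /cost -sumrB.
apply: ler_sum => i _; rewrite -mulrBr; apply: ler_wpM2l; first exact: powR_ge0.
have := lpgrad_subgradient (y - x i) p1 q1 (z - x i).
by rewrite /= opprB addrA subrK.
Qed.

Lemma subdifferential_monotone (R : realType) d (f : 'cV[R]_d -> R)
    (y z u v : 'cV[R]_d) :
  subdifferential f y u -> subdifferential f z v ->
  (u^T *m (z - y)) 0 0 <= (v^T *m (z - y)) 0 0.
Proof.
move=> /(_ z) fu /(_ y); rewrite -opprB mulmxN [leLHS]mxE; move: fu.
by move=> /=; lra.
Qed.

(** Half of the characterization of the directional derivative as the support
    function of the subdifferential. The selection of a subgradient at every
    point near [y] replaces the computation of difference quotients. *)
Lemma subdifferential_dot_le (R : realType) d m (x : 'I_m -> 'cV[R]_d)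
    (eta : 'I_m -> R) (p q : R) (y v h : 'cV[R]_d) (L : 'I_m -> R) :
  1 <= p -> 1 <= q ->
  (forall i, ((lpgrad p q (y - x i + s *: h))^T *m h) 0 0 @[s --> 0^'+]
     --> L i) ->
  subdifferential (cost x eta p q) y v ->
  (v^T *m h) 0 0 <= \sum_i eta i `^ q * L i.
Proof.
move=> p1 q1 gL vy.
have gC : \sum_i eta i `^ q * ((lpgrad p q (y - x i + s *: h))^T *m h) 0 0
    @[s --> 0^'+] --> \sum_i eta i `^ q * L i.
  apply: cvg_big; first exact: add_continuous.
  by move=> i _; apply: cvgM; [exact: cvg_cst|exact: gL].
apply: (cvgr_to_ge gC); near=> s.
have s0 : 0 < s by near: s; exact: nbhs_right_gt.
have := subdifferential_monotone vy
  (desing_subgradient_subdifferential x eta (y + s *: h) p1 q1).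
rewrite addrC addKr -!scalemxAr [leLHS]mxE [leRHS]mxE ler_pM2l//.
rewrite desing_subgradient_dotE => /le_trans; apply.
by apply: ler_sum => i _; rewrite addrAC.
Unshelve. all: by end_near. Qed.

(** * Limits of the gradient along a ray *)

Lemma cvg_ray (R : realType) d (w h : 'cV[R]_d) t :
  (w + s *: h) t 0 @[s --> 0^'+] --> w t 0.
Proof.
apply: cvg_at_right_filter.
under eq_fun do rewrite !mxE.
have : w t 0 + s * h t 0 @[s --> 0] --> w t 0 + 0 * h t 0.
  by apply: cvgD; [exact: cvg_cst|apply: cvgMl; exact: cvg_id].
by rewrite mul0r addr0.
Qed.

Lemma cvg_lpnorm_ray (R : realType) d (p : R) (w h : 'cV[R]_d) : 0 < p ->
  lpnorm p (w + s *: h) @[s --> 0^'+] --> lpnorm p w.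
Proof.
move=> p0; apply: cvg_powR_ge0; rewrite ?invr_gt0 ?sum_powR_ge0//.
  by move=> s; exact: sum_powR_ge0.
apply: cvg_big => [|t _]; first exact: add_continuous.
by apply: cvg_powR_ge0 => //; apply: cvg_norm; exact: cvg_ray.
Qed.

(** The factor |w_t|^(p-2) is singular at w_t = 0, but there the product
    |w_t|^(p-2) w_t has absolute value |w_t|^(p-1), which tends to 0 when
    p > 1. *)
Lemma cvg_lpgrad_coord (R : realType) d (p q : R) (w h : 'cV[R]_d) t :
  0 < p -> w != 0 -> (1 < p) || (w t 0 != 0) ->
  lpgrad p q (w + s *: h) t 0 @[s --> 0^'+] --> lpgrad p q w t 0.
Proof.
move=> p0 w0 pw.
have N0 : 0 < lpnorm p w by rewrite lt_neqAle lpnorm_ge0 eq_sym lpnorm_eq0 ?w0.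
rewrite mxE -mulrA; under eq_fun do rewrite mxE -mulrA.
apply: cvgM.
  apply: cvgM; first exact: cvg_cst.
  by apply: cvg_powR_gt0 => //; exact: cvg_lpnorm_ray.
have [wt0|wt0] := eqVneq (w t 0) 0; last first.
  apply: cvgM; last exact: cvg_ray.
  by apply: cvg_powR_gt0; [rewrite normr_gt0|apply: cvg_norm; exact: cvg_ray].
have p1 : 1 < p by move: pw; rewrite wt0 eqxx orbF.
rewrite wt0 mulr0; apply/norm_cvg0P.
under eq_fun do rewrite normrM (ger0_norm (powR_ge0 _ _)) powRB2M_norm//.
have p10 : p - 1 != 0 by rewrite gt_eqF ?subr_gt0.
have : `|(w + s *: h) t 0| `^ (p - 1) @[s --> 0^'+] --> `|w t 0| `^ (p - 1).
  by apply: cvg_powR_ge0; rewrite ?subr_gt0//; apply: cvg_norm; exact: cvg_ray.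
by rewrite wt0 normr0 powR0.
Qed.

Lemma cvg_lpgrad_ray (R : realType) d (p q : R) (w h : 'cV[R]_d) :
  1 < p -> w != 0 ->
  ((lpgrad p q (w + s *: h))^T *m h) 0 0 @[s --> 0^'+]
    --> ((lpgrad p q w)^T *m h) 0 0.
Proof.
move=> p1 w0; have p0 : 0 < p by lra.
under eq_fun do rewrite dotE.
rewrite dotE; apply: cvg_big => [|t _]; first exact: add_continuous.
by apply: cvgMl; apply: cvg_lpgrad_coord; rewrite ?p1.
Qed.

(** Euler's identity [lpgrad_dot_self] at the point s h, divided by s. *)
Lemma lpgrad_ray_dot (R : realType) d (p q s : R) (h : 'cV[R]_d) :
  0 < p -> 0 < q -> 0 < s ->
  ((lpgrad p q (s *: h))^T *m h) 0 0 = q * s `^ (q - 1) * lpnorm p h `^ q.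
Proof.
move=> p0 q0 s0; apply: (mulfI (lt0r_neq0 s0)).
have := lpgrad_dot_self (s *: h) p0 q0.
rewrite -scalemxAr mxE => ->; rewrite lpnormZ// gtr0_norm//.
rewrite powRM ?lpnorm_ge0 ?ltW// -(mulr_powRB1 (ltW s0) q0); ring.
Qed.

Lemma cvg_lpgrad_ray0 (R : realType) d (p q : R) (h : 'cV[R]_d) :
  0 < p -> 1 < q ->
  ((lpgrad p q (s *: h))^T *m h) 0 0 @[s --> 0^'+] --> 0.
Proof.
move=> p0 q1; have q0 : 0 < q by lra.
have q10 : 0 < q - 1 by lra.
have : q * s `^ (q - 1) * lpnorm p h `^ q @[s --> 0^'+]
    --> q * 0 * lpnorm p h `^ q.
  by apply: cvgMl; apply: cvgMr; exact: powR_cvg0.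
rewrite mulr0 mul0r; apply: cvg_trans.
by apply: near_eq_cvg; near=> s; rewrite lpgrad_ray_dot.
Unshelve. all: by end_near. Qed.

Lemma cvg_lpgrad_ray0_q1 (R : realType) d (p : R) (h : 'cV[R]_d) : 0 < p ->
  ((lpgrad p 1 (s *: h))^T *m h) 0 0 @[s --> 0^'+] --> lpnorm p h.
Proof.
move=> p0; apply: cvg_near_cst; near=> s.
by rewrite lpgrad_ray_dot// subrr powRr0 !mul1r powRr1 ?lpnorm_ge0.
Unshelve. all: by end_near. Qed.

(** For p = q = 1 the coordinate t of the gradient is the sign of w_t + s h_t:
    it is eventually constant, equal to the sign of h_t if w_t = 0. *)
Lemma cvg_lpgrad_ray_p1q1 (R : realType) d (w h : 'cV[R]_d) :
  ((lpgrad 1 1 (w + s *: h))^T *m h) 0 0 @[s --> 0^'+]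
    --> ((lpgrad 1 1 w)^T *m h) 0 0 + \sum_t (w t 0 == 0)%:R * `|h t 0|.
Proof.
under eq_fun do rewrite dotE.
rewrite dotE -big_split/=.
apply: cvg_big => [|t _]; first exact: add_continuous.
have [wt0|wt0] := eqVneq (w t 0) 0; last first.
  rewrite mul0r addr0; apply: cvgMl.
  apply: cvg_lpgrad_coord; rewrite ?wt0 ?orbT//.
  by apply: contra_neq wt0 => ->; rewrite mxE.
rewrite [X in X * _]mxE wt0 mulr0 mul0r add0r mul1r.
apply: cvg_near_cst; near=> s.
have s0 : 0 < s by near: s; exact: nbhs_right_gt.
rewrite !mxE wt0 add0r subrr powRr0 !mul1r; apply: (mulfI (lt0r_neq0 s0)).
have := sqrM_powRB2 (s * h t 0) (@ltr01 R).
rewrite powRr1// [X in _ = X]normrM (gtr0_norm s0) => <-; ring.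
Unshelve. all: by end_near. Qed.

(** Sharpens [lpgrad_subgradient] for p = q = 1: in a coordinate where w
    vanishes the l^1 norm grows by exactly |k_t|. *)
Lemma lpgrad_p1q1_le (R : realType) d (w k : 'cV[R]_d) :
  ((lpgrad 1 1 w)^T *m k) 0 0 + \sum_t (w t 0 == 0)%:R * `|k t 0|
    <= lpnorm 1 (w + k) - lpnorm 1 w.
Proof.
rewrite dotE !lpnorm1 -sumrB -big_split/=; apply: ler_sum => t _.
rewrite !mxE subrr powRr0 !mul1r.
have [->|wt0] := eqVneq (w t 0) 0.
  by rewrite mulr0 mul0r normr0 mul1r !add0r subr0.
rewrite (_ : 1 - 2 = -1); last by ring.
rewrite powR_inv1// mul0r addr0 -mulrA.
have nw : 0 < `|w t 0| by rewrite normr_gt0.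
rewrite ler_pdivrMl// mulrBr -expr2 real_normK ?num_real//.
rewrite lerBrDr -normrM; apply: le_trans (ler_norm _).
by rewrite mulrDr expr2 addrC.
Qed.

(** * The subdifferential of the cost *)

(** Test on h = v - u. *)
Lemma eq_dot_le (R : realType) d (u v : 'cV[R]_d) :
  (forall h : 'cV[R]_d, (v^T *m h) 0 0 <= (u^T *m h) 0 0) -> v = u.
Proof.
move=> /(_ (v - u)); rewrite !dotE -subr_le0 -sumrB.
under eq_bigr do rewrite -mulrBl.
move=> s0; apply/eqP; rewrite -subr_eq0; apply/eqP/matrixP => t j.
have sq_ge0 i : 0 <= (v i 0 - u i 0) * (v - u) i 0.
  by rewrite !mxE -expr2 sqr_ge0.
have /eqP : \sum_i (v i 0 - u i 0) * (v - u) i 0 = 0.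
  by apply/le_anti; rewrite s0 sumr_ge0.
rewrite psumr_eq0// => /allP /(_ t); rewrite mem_index_enum => /(_ isT)/=.
by rewrite ord1 !mxE -expr2 sqrf_eq0 => /eqP.
Qed.

(** All the terms N(y - x_i)^q are differentiable at y: a term that vanishes at
    y is a power q > 1 of the norm. *)
Lemma subdifferential_cost_smooth (R : realType) d m (x : 'I_m -> 'cV[R]_d)
    (eta : 'I_m -> R) (p q : R) (y : 'cV[R]_d) : 1 < p -> 1 <= q ->
  (1 < q \/ ~ range x y) ->
  subdifferential (cost x eta p q) y = [set desing_subgradient x eta p q y].
Proof.
move=> p1 q1 smooth; apply/seteqP; split=> [v vy|_ ->]; last first.
  by apply: desing_subgradient_subdifferential => //; exact: ltW.
apply: eq_dot_le => h; rewrite desing_subgradient_dotE.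
apply: (subdifferential_dot_le (ltW p1) q1 _ vy) => i.
have p0 : 0 < p by lra.
have [yx|yx] := eqVneq (y - x i) 0; last exact: cvg_lpgrad_ray.
rewrite yx lpgrad0 dotE big1; last by move=> t _; rewrite mxE mul0r.
under eq_fun do rewrite add0r.
case: smooth => [q1'|]; first exact: cvg_lpgrad_ray0.
by case; exists i => //; apply/esym/eqP; rewrite -subr_eq0 yx.
Qed.

(** As the points are distinct, the l-th term is the only one that is not
    differentiable at x_l, and its gradient formula contributes 0 to the
    de-singularity subgradient. *)
Lemma subdifferential_cost_anchor (R : realType) d m (x : 'I_m -> 'cV[R]_d)
    (eta : 'I_m -> R) (p r : R) (l : 'I_m) :
  injective x -> 0 < eta l -> 1 < p -> r^-1 + p^-1 = 1 ->
  subdifferential (cost x eta p 1) (x l) =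
  [set desing_subgradient x eta p 1 (x l) + eta l *: b | b in
    [set b : 'cV[R]_d | lpnorm r b <= 1]].
Proof.
move=> xI el0 p1 rp; set D := desing_subgradient _ _ _ _ _.
have p0 : 0 < p by lra.
have r0 : 0 < r.
  by rewrite -invr_gt0 (_ : r^-1 = 1 - p^-1) ?subr_gt0 ?invf_lt1// -rp; ring.
have el1 : eta l `^ 1 = eta l by rewrite powRr1// ltW.
apply/seteqP; split=> [v vy|_ [b b1 <-] z].
  exists ((eta l)^-1 *: (v - D)); last first.
    by rewrite scalerA mulfV ?gt_eqF// scale1r addrC subrK.
  apply: (lpnorm_dual_le1 p1 r0 rp) => h.
  rewrite linearZ -scalemxAl mxE dot_subE ler_pdivrMl//.
  rewrite lerBlDl /D desing_subgradient_dotE (bigD1 l)//= subrr lpgrad0.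
  rewrite [X in _ * X]dotE big1; last by move=> t _; rewrite mxE mul0r.
  rewrite mulr0 add0r.
  pose L i := if i == l then lpnorm p h
    else ((lpgrad p 1 (x l - x i))^T *m h) 0 0.
  have gL i : ((lpgrad p 1 (x l - x i + s *: h))^T *m h) 0 0 @[s --> 0^'+]
      --> L i.
    rewrite /L; have [->|il] := eqVneq i l.
      under eq_fun do rewrite subrr add0r.
      exact: cvg_lpgrad_ray0_q1.
    apply: cvg_lpgrad_ray => //.
    by rewrite subr_eq0; apply: contra_neq il => /xI.
  have := subdifferential_dot_le (ltW p1) (lexx 1) gL vy.
  rewrite (bigD1 l)//= el1 /L eqxx addrC => /le_trans; apply; rewrite lerD2r.
  by apply: ler_sum => i /negPf ->.
rewrite dot_addE desing_subgradient_dotE /cost -sumrB.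
rewrite (bigD1 l)//= [leRHS](bigD1 l)//= subrr lpgrad0.
rewrite [X in _ * X]dotE big1; last by move=> t _; rewrite mxE mul0r.
rewrite mulr0 add0r addrC lerD//.
  apply: ler_sum => i _; rewrite -mulrBr; apply: ler_wpM2l.
    exact: powR_ge0.
  have := lpgrad_subgradient (x l - x i) (ltW p1) (lexx 1) (z - x i).
  by rewrite /= opprB addrA subrK.
have /eqP -> : lpnorm p (0 : 'cV[R]_d) == 0 by rewrite lpnorm_eq0.
rewrite el1 !powRr1 ?lpnorm_ge0// mulr0 subr0 linearZ -scalemxAl mxE.
rewrite ler_pM2l//.
apply: le_trans (dot_le_lpnorm b (z - x l) p0 r0 rp) _.
by rewrite -[leRHS]mul1r ler_wpM2r ?lpnorm_ge0.
Qed.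

Lemma sum_singular_indexE (R : realType) d m (x : 'I_m -> 'cV[R]_d)
    (eta : 'I_m -> R) (y k : 'cV[R]_d) :
  \sum_i eta i * \sum_t ((y - x i) t 0 == 0)%:R * `|k t 0| =
  \sum_t (\sum_(i in singular_index x t y) eta i) * `|k t 0|.
Proof.
under eq_bigr do rewrite mulr_sumr.
rewrite exchange_big; apply: eq_bigr => t _.
rewrite mulr_suml [RHS]big_mkcond/=; apply: eq_bigr => i _.
by rewrite inE !mxE subr_eq0; case: ifP => _; rewrite ?mul1r// mul0r mulr0.
Qed.

(** The cost is a sum over t of functions of the t-th coordinate alone, and the
    slope of the t-th one jumps by 2 a_t at y_t. *)
Lemma subdifferential_cost_p1q1 (R : realType) d m (x : 'I_m -> 'cV[R]_d)
    (eta : 'I_m -> R) (y : 'cV[R]_d) : (forall i, 0 < eta i) ->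
  subdifferential (cost x eta 1 1) y =
  [set desing_subgradient x eta 1 1 y + u | u in
    [set u : 'cV[R]_d | forall t : 'I_d,
       - (\sum_(i in singular_index x t y) eta i) <= u t 0 /\
       u t 0 <= \sum_(i in singular_index x t y) eta i]].
Proof.
move=> e0; set D := desing_subgradient _ _ _ _ _.
pose a t := \sum_(i in singular_index x t y) eta i.
have e1 i : eta i `^ 1 = eta i by rewrite powRr1// ltW.
have D_dotE (k : 'cV[R]_d) : \sum_i eta i `^ 1 * (((lpgrad 1 1 (y - x i))^T *m k) 0 0 +
      \sum_t ((y - x i) t 0 == 0)%:R * `|k t 0|) =
    (D^T *m k) 0 0 + \sum_t a t * `|k t 0|.
  under eq_bigr do rewrite mulrDr.
  rewrite big_split/= -desing_subgradient_dotE; congr (_ + _).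
  by under eq_bigr do rewrite e1; exact: sum_singular_indexE.
apply/seteqP; split=> [v vy|_ [u ua <-] z].
  exists (v - D); last by rewrite addrC subrK.
  have vD c t : c * (v - D) t 0 <= a t * `|c|.
    have := subdifferential_dot_le (lexx 1) (lexx 1)
      (fun i => @cvg_lpgrad_ray_p1q1 _ _ (y - x i) (c *: delta_mx t 0)) vy.
    rewrite D_dotE -lerBlDl -dot_subE dotE.
    rewrite (bigD1 t)//= big1 ?addr0; last first.
      by move=> i it; rewrite !mxE (negPf it) mulr0 mulr0.
    rewrite [leRHS](bigD1 t)//= [X in _ <= _ + X]big1 ?addr0; last first.
      by move=> i it; rewrite !mxE (negPf it) mulr0 normr0 mulr0.
    have -> : (c *: delta_mx t 0 : 'cV[R]_d) t 0 = c.
      by rewrite !mxE !eqxx mulr1.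
    by rewrite mulrC.
  move=> t; have := vD 1 t; have := vD (-1) t; rewrite -/(a t).
  by rewrite normrN normr1; lra.
rewrite dot_addE.
apply: (@le_trans _ _ ((D^T *m (z - y)) 0 0 + \sum_t a t * `|(z - y) t 0|)).
  rewrite lerD2l dotE; apply: ler_sum => t _.
  apply: le_trans (ler_norm _) _; rewrite normrM ler_wpM2r// ler_norml.
  by have [-> ->] := ua t.
rewrite -D_dotE /cost -sumrB; apply: ler_sum => i _.
rewrite -mulrBr; apply: ler_wpM2l; first exact: powR_ge0.
have := lpgrad_p1q1_le (y - x i) (z - y).
rewrite [y - _ + _]addrC addrA subrK.
move: (lpnorm_ge0 1 (z - x i)) (lpnorm_ge0 1 (y - x i)).
move: (lpnorm 1 (z - x i)) (lpnorm 1 (y - x i)) => Nz Ny Nz0 Ny0.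
by rewrite !powRr1.
Qed.

Theorem theorem6 (R : realType) (d m : nat) (x : 'I_m -> 'cV[R]_d)
    (eta : 'I_m -> R) (x_distinct : injective x)
    (x_noncollinear : ~ collinear x) (eta_gt0 : forall i, 0 < eta i)
    (p q : R) (p_ge1 : 1 <= p) (p_lt2 : p < 2) (q_ge1 : 1 <= q) (q_le_p : q <= p)
    (y : 'cV[R]_d) (y_sing : singular_set x y) :
  [/\ p = 1 -> q = 1 ->
        subdifferential (cost x eta p q) y =
        [set desing_subgradient x eta p q y + u | u in
          [set u : 'cV[R]_d | forall t : 'I_d,
             - (\sum_(i in singular_index x t y) eta i) <= u t 0 /\
             u t 0 <= \sum_(i in singular_index x t y) eta i]],
      q = 1 -> 1 < p -> ~ range x y ->
        subdifferential (cost x eta p q) y =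
        [set desing_subgradient x eta p q y],
      forall l : 'I_m, q = 1 -> 1 < p -> y = x l ->
        forall r : R, r^-1 + p^-1 = 1 ->
        subdifferential (cost x eta p q) y =
        [set desing_subgradient x eta p q y + eta l *: b | b in
          [set b : 'cV[R]_d | lpnorm r b <= 1]]
    & 1 < q -> 1 < p ->
        subdifferential (cost x eta p q) y =
        [set desing_subgradient x eta p q y]].
Proof.
split.
- by move=> -> ->; exact: subdifferential_cost_p1q1.
- by move=> _ p1 yx; apply: subdifferential_cost_smooth => //; right.
- move=> l -> p1 -> r rp; exact: subdifferential_cost_anchor.
- by move=> q1 p1; apply: subdifferential_cost_smooth => //; left.
Qed.
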